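(* Let $q$ be a prime power, $\alpha$ a primitive element of $\mathbf{F}_q$, $k$ an integer with $1\le k\le q-2$, and $d=q-k$. Let $g(x)=(x-\alpha)(x-\alpha^2)\cdots(x-\alpha^{d-1})$ and let $\mathcal{C}=\{g(x)m(x): m\in\mathbf{F}_q[x],\ \deg m\le k-1\}$. Let $g_2(x)=g(x)/(x-\alpha^{d-1})$. Then for every $a\in\mathbf{F}_q^*$ and every $l\in\mathbf{F}_q[x]$ with $\deg l\le k-1$, the polynomial $a g_2(x)+l(x)g(x)$ is a deep hole of $\mathcal{C}$, i.e. $d(ag_2+lg,\mathcal{C})=q-1-k$.
   Context: Polynomials of degree at most $q-2$ are identified with their coefficient vectors in $\mathbf{F}_q^{q-1}$. The distance $d(s,t)$ between two such polynomials is the number of indices $i\in\{0,\dots,q-2\}$ at which the coefficients of $x^i$ in $s$ and $t$ differ, and $d(u,\mathcal{C})=\min\{d(u,c):c\in\mathcal{C}\}$. A polynomial $u$ of degree at most $q-2$ is a deep hole of $\mathcal{C}$ if $d(u,\mathcal{C})=q-1-k$. *)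

(* Defs.v *)
From mathcomp Require Import all_boot all_algebra.

Set Implicit Arguments.
Unset Strict Implicit.
Unset Printing Implicit Defensive.

Import GRing.Theory.
Local Open Scope ring_scope.

(* Hamming distance of the coefficient vectors in F^n; meaningful for
   polynomials of degree < n. *)
Definition coef_dist (F : fieldType) (n : nat) (s t : {poly F}) : nat :=
  #|[set i : 'I_n | s`_i != t`_i]|.

(* d(u, C) = r, where d(u, C) = min {d(u, c) : c in C}: the minimum is attained
   by r and bounded below by r. *)
Definition code_dist_is (F : fieldType) (n : nat) (u : {poly F})
    (C : {poly F} -> Prop) (r : nat) : Prop :=
  (exists2 c, C c & coef_dist n u c = r) /\
  (forall c, C c -> (r <= coef_dist n u c)%N).

(* n is the code length and k its dimension; here n = q - 1, hence q - 1 - k. *)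
Definition deep_hole (F : fieldType) (n k : nat) (C : {poly F} -> Prop)
    (u : {poly F}) : Prop :=
  (size u <= n)%N /\ code_dist_is n u C (n - k).

(* (x - alpha) (x - alpha^2) ... (x - alpha^(d-1)) *)
Definition rs_gen (F : fieldType) (alpha : F) (d : nat) : {poly F} :=
  \prod_(1 <= i < d) ('X - (alpha ^+ i)%:P).

(* deg m <= k - 1 is size m <= k, which also admits m = 0. *)
Definition rs_code (F : fieldType) (g : {poly F}) (k : nat)
    (c : {poly F}) : Prop :=
  exists2 m : {poly F}, (size m <= k)%N & c = g * m.

(* Main.v *)
Require Import Defs.
From mathcomp Require Import all_boot all_algebra.
From mathcomp Require Import zify.

Set Implicit Arguments.
Unset Strict Implicit.
Unset Printing Implicit Defensive.

Import GRing.Theory.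
Local Open Scope ring_scope.

(** The difference of [a g2 + l g] and a codeword is a nonzero polynomial
    multiple of [g2] of degree less than [q - 1], so it vanishes at the [d - 2]
    consecutive powers [alpha, ..., alpha^(d-2)]; by the BCH bound at least
    [d - 1 = q - 1 - k] of its coefficients are nonzero.  The codeword [l g]
    attains the bound, because [a g2] has only [d - 1] coefficients. *)

(* If the support T of p had at most w elements, testing p against
   f = prod_(j in T \ i0) (X - alpha^j), of degree less than w, would give
   sum_i p_i alpha^i f(alpha^i) = sum_j f_j p(alpha^(j+1)) = 0, whereas only
   the nonzero term i = i0 survives on the left. *)
Lemma BCH_bound (F : fieldType) (n w : nat) (alpha : F) (p : {poly F}) :
  n.-primitive_root alpha -> (size p <= n)%N -> p != 0 ->
  (forall j, (1 <= j <= w)%N -> root p (alpha ^+ j)) ->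
  (w < #|[set i : 'I_n | (p`_i != 0)%R]|)%N.
Proof.
move=> prim_a sz_p nz_p p_root; rewrite ltnNge; apply/negP => le_Tw.
set T := [set i : 'I_n | p`_i != 0] in le_Tw.
have lt_dp : ((size p).-1 < n)%N by rewrite prednK ?size_poly_gt0.
pose i0 := Ordinal lt_dp.
have Ti0 : i0 \in T by rewrite inE /= -lead_coefE lead_coef_eq0.
pose f : {poly F} := \prod_(j in T :\ i0) ('X - (alpha ^+ j)%:P).
have sz_f : (size f <= w)%N.
  rewrite /f -big_enum size_prod_XsubC -cardE.
  by have := cardsD1 i0 T; rewrite Ti0 add1n => <-.
have sum0 : \sum_(i < n) p`_i * alpha ^+ i * f.[alpha ^+ i] = 0.
  transitivity (\sum_(j < w) f`_j * p.[alpha ^+ j.+1]); last first.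
    by apply: big1 => j _; rewrite (rootP (p_root _ _)) ?mulr0 //= ltn_ord.
  under eq_bigr => i _ do rewrite (horner_coef_wide _ sz_f) mulr_sumr.
  rewrite exchange_big /=; apply: eq_bigr => j _.
  rewrite (horner_coef_wide _ sz_p) mulr_sumr; apply: eq_bigr => i _.
  (* The weight [alpha ^+ i] turns [alpha ^+ (i * j)] into the [i]-th power of [alpha ^+ j.+1], so
     the evaluation points start at [alpha], not at 1. *)
  by rewrite -!exprM mulrCA -mulrA -exprD mulSn [(i * j)%N]mulnC.
have i0_term : p`_i0 * alpha ^+ i0 * f.[alpha ^+ i0] != 0.
  rewrite !mulf_neq0 //; first by rewrite inE in Ti0.
    have n_gt0 := prim_order_gt0 prim_a.
    rewrite expf_neq0 //; apply/eqP => a0.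
    have := prim_expr_order prim_a.
    by move/eqP; rewrite a0 expr0n gtn_eqF // eq_sym oner_eq0.
  rewrite horner_prod prodf_seq_neq0; apply/allP => j _ /=; apply/implyP.
  rewrite !inE hornerXsubC subr_eq0 => /andP[ne_ji0 _].
  (* Exponents below the order [n] of [alpha] give distinct powers. *)
  rewrite (eq_prim_root_expr prim_a) !modn_small // eq_sym.
  by apply: contra ne_ji0 => /eqP eq_ji0; apply/eqP/val_inj.
case/eqP: i0_term; rewrite -[RHS]sum0 (bigD1 i0) //= big1 ?addr0 // => i ne_i.
have [-> | nz_pi] := eqVneq p`_i 0; first by rewrite !mul0r.
rewrite /f horner_prod (bigD1 i) ?inE ?ne_i //=.
by rewrite hornerXsubC subrr mul0r mulr0.
Qed.

Lemma coef_dist_sub (F : fieldType) (n : nat) (s t : {poly F}) :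
  coef_dist n s t = #|[set i : 'I_n | (s - t)`_i != 0]|.
Proof. by apply: eq_card => i; rewrite !inE coefB subr_eq0. Qed.

Lemma leq_card_support_size (R : nzRingType) (n : nat) (p : {poly R}) :
  (#|[set i : 'I_n | (p`_i != 0)%R]| <= size p)%N.
Proof.
have -> : size p = #|'I_(size p)| by rewrite card_ord.
have supp_lt (i : 'I_n) : p`_i != 0 -> (i < size p)%N.
  by move=> nz_pi; rewrite ltnNge; apply: contra nz_pi => /leq_sizeP ->.
(* The map of the support into ['I_(size p)] needs a default value, hence [p] nonzero; on the
   support the default is never taken, so the map is injective. *)
have [-> | nz_p] := eqVneq p 0.
  by rewrite (_ : [set _ | _] = set0) ?cards0 //; apply/setP=> i; rewrite !inE coef0 eqxx.
have sz_p : (0 < size p)%N by rewrite size_poly_gt0.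
rewrite -(card_in_imset (f := fun i : 'I_n => insubd (Ordinal sz_p) (val i))).
  exact: max_card.
move=> i j; rewrite !inE => /supp_lt lt_i /supp_lt lt_j /(congr1 val).
by rewrite !val_insubd lt_i lt_j => /val_inj.
Qed.

Lemma size_rs_gen (F : fieldType) (alpha : F) (d : nat) :
  size (rs_gen alpha d) = d.-1.+1.
Proof. by rewrite /rs_gen size_prod_XsubC size_iota subn1. Qed.

Lemma root_rs_gen (F : fieldType) (alpha : F) (d j : nat) :
  (1 <= j < d)%N -> root (rs_gen alpha d) (alpha ^+ j).
Proof.
move=> j_lt; rewrite /rs_gen (big_rem j) /= ?mem_index_iota //.
by rewrite rootM root_XsubC eqxx.
Qed.

Theorem theorem2p4 (q : nat) (F : finFieldType) (hq : #|F| = q)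
    (alpha : F) (halpha : (q - 1).-primitive_root alpha)
    (k : nat) (hk : (1 <= k <= q - 2)%N)
    (d : nat) (hd : d = (q - k)%N)
    (g : {poly F}) (hg : g = rs_gen alpha d)
    (g2 : {poly F}) (hg2 : g2 = g %/ ('X - (alpha ^+ (d - 1))%:P))
    (a : F) (ha : a != 0)
    (l : {poly F}) (hl : (size l <= k)%N) :
  deep_hole (q - 1) k (rs_code g k) (a *: g2 + l * g).
Proof.
(* [k <= q - 2] gives [d >= 2]; [e = d - 2] counts the roots listed in [g2]. *)
have [e de] : exists e, d = e.+2 by exists (q - k - 2)%N; lia.
pose b := alpha ^+ e.+1.
have defg : g = rs_gen alpha e.+1 * ('X - b%:P).
  by rewrite hg de /rs_gen big_nat_recr.
have defg2 : g2 = rs_gen alpha e.+1.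
  by rewrite hg2 defg de subn1 mulpK // polyXsubC_eq0.
have sz_g2 : size g2 = e.+1 by rewrite defg2 size_rs_gen.
have sz_g : size g = e.+2 by rewrite hg de size_rs_gen.
have sz_word (m : {poly F}) : (size m <= k)%N ->
    (size (a *: g2 + m * g)%R <= q - 1)%N.
  move=> sz_m; apply: leq_trans (size_polyD _ _) _.
  rewrite size_scale // sz_g2 geq_max.
  (* The product [m * g] has size at most [k + d - 1 = q - 1]. *)
  have := size_polyMleq m g; rewrite sz_g; lia.
have weight (m : {poly F}) : (size m <= k)%N ->
    (q - 1 - k <= #|[set i : 'I_(q - 1) | ((a *: g2 + m * g)`_i != 0)%R]|)%N.
  move=> sz_m; have -> : (q - 1 - k = e.+1)%N by lia.
  have fact : a *: g2 + m * g = g2 * (a%:P + m * ('X - b%:P)).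
    by rewrite mulrDr [g2 * a%:P]mulrC mul_polyC defg -defg2 mulrCA.
  apply: (BCH_bound halpha (sz_word m sz_m)) => [|j j_le]; rewrite fact.
    (* The cofactor of [g2] takes the value [a] at [b], the root of [g] split off, so it is
       nonzero. *)
    rewrite mulf_neq0 -?size_poly_eq0 ?sz_g2 // size_poly_eq0.
    apply: contraNneq ha => /(congr1 (horner^~ b)).
    by rewrite !hornerE subrr mulr0 addr0 => ->.
  by rewrite rootM defg2 root_rs_gen.
(* Subtracting a codeword only replaces [l] by [l - m], so [weight] covers every distance. *)
have dist_code (m : {poly F}) :
    coef_dist (q - 1) (a *: g2 + l * g) (g * m) =
    #|[set i : 'I_(q - 1) | (a *: g2 + (l - m) * g)`_i != 0]|.
  by rewrite coef_dist_sub [g * m]mulrC -addrA -mulrBl.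
split; first exact: sz_word.
split=> [|_ [m sz_m ->]]; last first.
  rewrite dist_code; apply: weight.
  by rewrite (leq_trans (size_polyD _ _)) // size_polyN geq_max hl.
exists (g * l); first by exists l.
(* Here the difference is [a *: g2]: [weight] at 0 bounds its support below, its size [e.+1]
   above. *)
rewrite dist_code subrr; apply/eqP; rewrite eqn_leq weight ?size_poly0 // andbT.
rewrite mul0r addr0 (leq_trans (leq_card_support_size _ _)) //.
rewrite size_scale // sz_g2; lia.
Qed.
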